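(* Let $G$ be any $d$-regular graph, $u\in V$, $S$ be a set of trajectories of length $t>0$ starting from $u$, and $0\le\varepsilon \leq 1/d^{2\eta}$ for some $0< \eta \leq 1$. Then, for any strategy taken by the $\varepsilon$-TBRW, \[ q_{u,S}(\varepsilon) \le \exp\bigl( 4 t / d^{\eta} \bigr) \cdot (p_{u,S})^{\eta/(1 + \eta)}. \]
   Context: All graphs are finite, simple, undirected and connected. A trajectory of length $t$ from $u$ is a sequence $x_0=u,x_1,\dots,x_t$ of vertices with consecutive vertices adjacent. The simple random walk (SRW) moves in each step to a uniformly random neighbour. The $\varepsilon$-time-biased random walk ($\varepsilon$-TBRW), $\varepsilon\in[0,1]$, is the following process $(X_t)_{t\ge0}$ on $V(G)$: in each step, independently, with probability $1-\varepsilon$ the walk moves to a uniformly random neighbour of the current vertex, and with probability $\varepsilon$ it moves to a neighbour sampled from a probability distribution on the neighbours chosen by a controller; this distribution may depend on the whole history $X_0,\dots,X_t$. A strategy is a rule specifying these choices. $p_{u,S}$ is the probability that the trajectory of a $t$-step SRW started from $u$ is in $S$, and $q_{u,S}(\varepsilon)$ is the corresponding probability for the $\varepsilon$-TBRW under the given strategy. *)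

(* Defs.v *)
From mathcomp Require Import all_boot all_order all_algebra.
From mathcomp Require Import all_classical all_reals all_analysis.

Set Implicit Arguments.
Unset Strict Implicit.
Unset Printing Implicit Defensive.

Import Order.TTheory GRing.Theory Num.Theory.
Local Open Scope ring_scope.

(* As in path.v, a trajectory x_0, x_1, ..., x_n is given by its starting
   vertex x_0 and the sequence [:: x_1; ...; x_n]; it is a trajectory of the
   graph e when path e x_0 [:: x_1; ...; x_n].                              *)

Definition simple_graph (T : finType) (e : rel T) : Prop :=
  symmetric e /\ irreflexive e.

Definition connected_graph (T : finType) (e : rel T) : Prop :=
  forall x y : T, connect e x y.

Definition regular_graph (T : finType) (e : rel T) (d : nat) : Prop :=
  forall x : T, #|[set y | e x y]| = d.

Definition distribution_on (R : realType) (T : finType) (A : {set T})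
    (mu : T -> R) : Prop :=
  [/\ forall y, 0 <= mu y,
      forall y, y \notin A -> mu y = 0
    & \sum_(y : T) mu y = 1].

(* K x_0 [:: x_1; ...; x_n] y is the probability of X_{n+1} = y conditionally
   on the history (X_0, ..., X_n) = (x_0, ..., x_n).                        *)
Definition step_law (R : realType) (T : finType) : Type :=
  T -> seq T -> T -> R.

Definition is_strategy (R : realType) (T : finType) (e : rel T)
    (sigma : step_law R T) : Prop :=
  forall (x0 : T) (h : seq T), path e x0 h ->
    distribution_on [set y | e (last x0 h) y] (sigma x0 h).

Definition srw (R : realType) (T : finType) (e : rel T) : step_law R T :=
  fun x0 h y =>
    let N := [set z | e (last x0 h) z] in
    if y \in N then #|N|%:R^-1 else 0.

Definition tbrw (R : realType) (T : finType) (e : rel T) (eps : R)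
    (sigma : step_law R T) : step_law R T :=
  fun x0 h y => (1 - eps) * srw R e x0 h y + eps * sigma x0 h y.

(* The chain rule: P(X_1 = x_1, ..., X_t = x_t) for the walk started from
   X_0 = u.                                                                 *)
Definition trajectory_prob (R : realType) (T : finType) (K : step_law R T)
    (u : T) (t : nat) (x : t.-tuple T) : R :=
  \prod_(i < t) K u (take i x) (tnth x i).

Definition walk_prob (R : realType) (T : finType) (K : step_law R T)
    (u : T) (t : nat) (S : {set t.-tuple T}) : R :=
  \sum_(x in S) trajectory_prob K u x.

(* Main.v *)
Require Import Defs.
From mathcomp Require Import all_boot all_order all_algebra.
From mathcomp Require Import all_classical all_reals all_analysis.
From mathcomp Require Import ring lra.

Set Implicit Arguments.
Unset Strict Implicit.
Unset Printing Implicit Defensive.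

Import Order.TTheory GRing.Theory Num.Theory.
Local Open Scope ring_scope.

(** Write q(x) for the probability that the biased walk follows the
    trajectory x; the simple walk follows each path of length t with the same
    probability d^-t, so that p_S = |S| d^-t.  Hoelder's inequality with
    exponent 1 + eta compares the two ([sum_powR_le] with r = 1/(1 + eta)):

      q_S <= |S|^(eta/(1 + eta)) * (sum_(x in S) q(x)^(1 + eta))^(1/(1 + eta)).

    It remains to bound the sum of the q(x)^(1 + eta), which may be taken over
    all paths of length t from u.  Since q(x) is a product of step
    probabilities, this follows from a bound on one step, uniform in the
    history ([sum_paths_trajectory_prob_le]).  Write b = d^-eta.  A step moves
    to the neighbour y with probability q_y = (1 - eps)/d + eps mu_y, mu being
    the law chosen by the controller, and

      sum_y q_y^(1 + eta) = (1 - eps)/d * sum_y q_y^eta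
                            + eps * sum_y mu_y q_y^eta.

    In the first term concavity gives sum_y q_y^eta <= d^(1 - eta); in the
    second q_y <= 1.  As eps <= b^2, the total is at most
    b + b^2 = b (1 + b) ([sum_mixture_powR_le]).  Over t steps this yields
    b^t (1 + b)^t; the factor b^t = (d^-t)^eta combines with |S|^eta into
    p_S^eta, up to the outer power 1/(1 + eta), and (1 + b)^t <= exp(t b),
    which is stronger than the required exp(4 t b). *)

(** * Power functions *)

(** The concave function x^r lies below its tangent at 1; this is Young's
    inequality for x^r and 1 with exponents 1/r and 1/(1 - r). *)
Lemma powR_le_tangent (R : realType) (x r : R) :
  0 <= x -> 0 < r -> r <= 1 -> x `^ r <= r * x + (1 - r).
Proof.
move=> x0 r0; rewrite le_eqVlt => /orP[/eqP->|r1].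
  by rewrite powRr1 // mul1r subrr addr0.
have r1' : 0 < 1 - r by rewrite subr_gt0.
have := @conjugate_powR R (x `^ r) 1 r^-1 (1 - r)^-1 (powR_ge0 _ _) ler01.
rewrite !invr_gt0 !invrK mulr1 powR1 mul1r -powRrM mulfV ?gt_eqF //.
rewrite powRr1 // (mulrC x); apply => //; ring.
Qed.

(** Jensen's inequality for x^r: the tangent bound is applied to g i / m, where
    m is the mean of g, and the linear terms sum to |A|.  Applied with g = f^p
    and r = 1/p it is Hoelder's inequality for f against the constant 1. *)
Lemma sum_powR_le (R : realType) (I : finType) (A : {set I}) (g : I -> R)
    (r : R) :
  0 < r -> r <= 1 -> (forall i, i \in A -> 0 <= g i) ->
  \sum_(i in A) g i `^ r <= #|A|%:R `^ (1 - r) * (\sum_(i in A) g i) `^ r.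
Proof.
move=> r0 r1 g0; set s := \sum_(i in A) g i.
have s0 : 0 <= s by apply: sumr_ge0.
have [s_eq0|s_neq0] := eqVneq s 0.
  rewrite big1 ?mulr_ge0 ?powR_ge0 // => i iA.
  move/eqP: s_eq0; rewrite /s psumr_eq0 // => /allP/(_ i (mem_index_enum _)).
  by rewrite iA => /eqP ->; rewrite powR0 // gt_eqF.
have n0 : 0 < #|A|%:R :> R.
  rewrite ltr0n card_gt0; apply: contra_neq s_neq0 => A0.
  by rewrite /s A0 big_set0.
set n := #|A|%:R in n0 *; pose m := s / n.
have m0 : 0 < m by rewrite divr_gt0 // lt_def s_neq0.
have -> : n `^ (1 - r) * s `^ r
    = \sum_(i in A) m `^ r * (r * (g i / m) + (1 - r)).
  rewrite -mulr_sumr big_split /= -mulr_sumr -mulr_suml -/s.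
  rewrite sumr_const -[_ *+ _]mulr_natr -/n.
  have -> : s / m = n by rewrite /m; field; rewrite s_neq0 gt_eqF.
  have -> : s = m * n by rewrite /m divfK // gt_eqF.
  rewrite powRM ?(ltW m0) ?(ltW n0) // mulrCA -powRD ?(gt_eqF n0) ?implybT //.
  by rewrite subrK powRr1 ?(ltW n0) //; ring.
apply: ler_sum => i iA.
have -> : g i `^ r = m `^ r * (g i / m) `^ r.
  by rewrite -powRM ?(ltW m0) ?divr_ge0 ?g0 ?(ltW m0)// mulrC divfK // gt_eqF.
by rewrite ler_wpM2l ?powR_ge0 // powR_le_tangent // divr_ge0 ?g0 // ltW.
Qed.

Lemma powR_prod (R : realType) (I : Type) (s : seq I) (P : pred I)
    (F : I -> R) (r : R) :
  (forall i, P i -> 0 <= F i) ->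
  (\prod_(i <- s | P i) F i) `^ r = \prod_(i <- s | P i) F i `^ r.
Proof.
move=> F0; elim: s => [|i s IHs]; first by rewrite !big_nil powR1.
rewrite !big_cons; case: ifP => // Pi.
by rewrite powRM ?F0 ?prodr_ge0 // IHs.
Qed.

(** * Chain rule along paths *)

Lemma path_take (T : Type) (e : rel T) (u : T) (s : seq T) (i : nat) :
  path e u s -> path e u (take i s).
Proof. by rewrite -{1}(cat_take_drop i s) cat_path => /andP[]. Qed.

Lemma path_last_take (T : Type) (e : rel T) (u : T) (t : nat) (x : t.-tuple T)
    (i : 'I_t) :
  path e u x -> e (last u (take i x)) (tnth x i).
Proof.
rewrite -{1}(cat_take_drop i x) (drop_nth (tnth x i)) ?size_tuple //.
by rewrite cat_path /= -tnth_nth => /and3P[].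
Qed.

Lemma trajectory_prob_rcons (R : realType) (T : finType) (K : step_law R T)
    (u : T) (t : nat) (x : t.-tuple T) (y : T) :
  trajectory_prob K u [tuple of rcons x y] = trajectory_prob K u x * K u x y.
Proof.
rewrite /trajectory_prob big_ord_recr /=; congr (_ * _).
  apply: eq_bigr => i _; rewrite !(tnth_nth y) /= nth_rcons size_tuple ltn_ord.
  by rewrite -cats1 takel_cat // size_tuple ltnW.
rewrite (tnth_nth y) /= nth_rcons size_tuple ltnn eqxx.
by rewrite -cats1 take_size_cat ?size_tuple.
Qed.

(** Summation over the last step, which is what the chain rule needs since the
    law of a step depends on everything before it. *)
Lemma sum_tuple_rcons (R : realType) (T : finType) (t : nat)
    (P : pred (seq T)) (F : t.+1.-tuple T -> R) :
  \sum_(x : t.+1.-tuple T | P x) F x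
  = \sum_(x : t.-tuple T) \sum_(y : T | P (rcons x y)) F [tuple of rcons x y].
Proof.
rewrite pair_big_dep /=.
rewrite (reindex (fun p : t.-tuple T * T => [tuple of rcons p.1 p.2])) //=.
apply: onW_bij.
exists (fun z : t.+1.-tuple T =>
  ([tuple of belast (thead z) (behead z)], last (thead z) (behead z))).
  case=> x y; congr pair; rewrite /thead ?(tnth_nth y) /=.
    by apply: val_inj; rewrite /=; case: (val x) => //= a s;
      rewrite belast_rcons.
  by case: (val x) => //= a s; rewrite last_rcons.
move=> z; apply: val_inj; case/tupleP: z => a z /=.
by rewrite theadE -lastI.
Qed.

(** With F the (1 + eta)-th power of a step law, a uniform one-step bound on
    moments multiplies along the walk.  Only paths are summed over, because a
    strategy is constrained only after a history which is a path. *)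
Lemma sum_paths_trajectory_prob_le (R : realType) (T : finType) (e : rel T)
    (F : step_law R T) (u : T) (c : R) (t : nat) :
  (forall h y, 0 <= F u h y) ->
  (forall h, path e u h -> \sum_(y | e (last u h) y) F u h y <= c) ->
  \sum_(x : t.-tuple T | path e u x) trajectory_prob F u x <= c ^+ t.
Proof.
move=> F0 Fc; elim: t => [|t IHt].
  rewrite expr0 (big_pred1 [tuple]) => [|x]; last by rewrite (tuple0 x).
  by rewrite /trajectory_prob big_ord0.
have c0 : 0 <= c by apply: le_trans (Fc [::] isT); apply: sumr_ge0.
rewrite sum_tuple_rcons exprSr.
apply: (@le_trans _ _
  (\sum_(x : t.-tuple T | path e u x) trajectory_prob F u x * c)); last first.
  by rewrite -mulr_suml ler_wpM2r.
rewrite [leRHS]big_mkcond /=; apply: ler_sum => x _.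
under eq_bigl => y do rewrite rcons_path.
case: ifP => ux; last by rewrite big_pred0.
under eq_bigr => y _ do rewrite trajectory_prob_rcons.
rewrite -mulr_sumr ler_wpM2l ?Fc // prodr_ge0 // => i _; exact: F0.
Qed.

(** * Moments of the biased walk *)

(** The one-step moment bound.  One factor q_y is split off the power
    q_y^(1 + eta): its uniform part (1 - eps)/d is averaged by concavity, while
    in its adversarial part eps mu_y the remaining q_y^eta is bounded by 1,
    at the price of a term eps <= b^2. *)
Lemma sum_mixture_powR_le (R : realType) (T : finType) (A : {set T})
    (mu : T -> R) (eta eps : R) :
  distribution_on A mu -> (0 < #|A|)%N -> 0 < eta -> eta <= 1 ->
  0 <= eps -> eps <= (#|A|%:R `^ eta)^-1 ^+ 2 ->
  \sum_(y in A) ((1 - eps) / #|A|%:R + eps * mu y) `^ (1 + eta)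
    <= (#|A|%:R `^ eta)^-1 * (1 + (#|A|%:R `^ eta)^-1).
Proof.
case=> mu0 muA mu1 cardA eta0 eta1 eps0; set d := #|A|%:R; set b := _^-1.
move=> eps_le.
have d1 : 1 <= d by rewrite ler1n.
have d0 : 0 < d by rewrite ltr0n.
have b0 : 0 < b by rewrite invr_gt0 powR_gt0.
have b1 : b <= 1 by rewrite invf_le1 ?powR_gt0 // -(powRr0 d) ler_powR // ltW.
have eps1 : eps <= 1 by rewrite (le_trans eps_le) // exprn_ile1 // ltW.
have sum_mu : \sum_(y in A) mu y = 1.
  by rewrite -mu1 [RHS](bigID [in A]) /= [X in _ + X]big1 ?addr0.
pose q y := (1 - eps) / d + eps * mu y.
have q0 y : 0 <= q y by rewrite addr_ge0 ?mulr_ge0 ?invr_ge0 ?subr_ge0 ?(ltW d0).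
have sum_q : \sum_(y in A) q y = 1.
  rewrite big_split /= sumr_const -mulr_sumr sum_mu -[_ *+ _]mulr_natr -/d.
  by field; rewrite gt_eqF.
have q_le1 y : y \in A -> q y <= 1.
  by move=> yA; rewrite -sum_q (bigD1 y) //= lerDl sumr_ge0.
have qq y : q y `^ (1 + eta)
    = (1 - eps) / d * q y `^ eta + eps * (mu y * q y `^ eta).
  rewrite powRD ?powRr1 //; last by rewrite (gt_eqF (addr_gt0 ltr01 eta0)).
  by rewrite {1}/q mulrDl mulrA.
rewrite (eq_bigr _ (fun y _ => qq y)) /= big_split /= -!mulr_sumr.
have sum1 : (1 - eps) / d * \sum_(y in A) q y `^ eta <= (1 - eps) * b.
  rewrite -mulrA ler_wpM2l ?subr_ge0 // ler_pdivrMl // /b -powRN.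
  have := @sum_powR_le R T A q eta eta0 eta1 (fun y _ => q0 y).
  rewrite sum_q powR1 mulr1 -/d powRD ?(gt_eqF d0) ?implybT //.
  by rewrite powRr1 // ltW.
have sum2 : \sum_(y in A) mu y * q y `^ eta <= 1.
  rewrite -sum_mu; apply: ler_sum => y yA.
  have q1 : q y `^ eta <= 1 `^ eta.
    by rewrite ge0_ler_powR ?(ltW eta0) ?nnegrE ?q_le1.
  by rewrite ler_piMr // (le_trans q1) ?powR1.
(* (1 - eps) b + eps <= b + b^2 *)
nra.
Qed.

Theorem theorem1p7 (R : realType) (T : finType) (e : rel T) (d : nat)
    (he_simple : simple_graph e) (he_conn : connected_graph e)
    (he_reg : regular_graph e d)
    (u : T) (t : nat) (ht : (0 < t)%N)
    (S : {set t.-tuple T}) (hS : forall x : t.-tuple T, x \in S -> path e u x)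
    (eta : R) (heta0 : 0 < eta) (heta1 : eta <= 1)
    (eps : R) (heps0 : 0 <= eps) (heps1 : eps <= 1 / (d%:R `^ (2 * eta)))
    (sigma : step_law R T) (hsigma : is_strategy e sigma) :
  walk_prob (tbrw e eps sigma) u S
    <= expR (4 * t%:R / (d%:R `^ eta))
       * (walk_prob (srw R e) u S) `^ (eta / (1 + eta)).
Proof.
have [->|[x0 x0S]] := set_0Vmem S.
  by rewrite {1}/walk_prob big_set0 mulr_ge0 ?expR_ge0 ?powR_ge0.
(* S contains a path with at least one step, so the degree is positive. *)
have d_gt0 : (0 < d)%N.
  rewrite -(he_reg (last u (take (Ordinal ht) x0))) card_gt0.
  apply/set0Pn; exists (tnth x0 (Ordinal ht)).
  by rewrite inE path_last_take // hS.
have dR0 : 0 < d%:R :> R by rewrite ltr0n.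
set b := (d%:R `^ eta)^-1.
have b0 : 0 < b by rewrite invr_gt0 powR_gt0.
have heps : eps <= b ^+ 2.
  by rewrite (le_trans heps1) // mul1r mulrC powRrM powR_mulrn ?powR_ge0 // exprVn.
have eps1 : eps <= 1.
  rewrite (le_trans heps) // exprn_ile1 ?(ltW b0) // invf_le1 ?powR_gt0 //.
  by rewrite -[leLHS](powRr0 d%:R) ler_powR ?ler1n // ltW.
have srwE h y : e (last u h) y -> srw R e u h y = d%:R^-1.
  by move=> hy; rewrite /srw inE hy he_reg.
have srw_S x : x \in S -> trajectory_prob (srw R e) u x = d%:R^-1 ^+ t.
  move=> /hS ux; rewrite /trajectory_prob.
  under eq_bigr => i _ do rewrite srwE ?path_last_take //.
  by rewrite prodr_const card_ord.
pose q := tbrw e eps sigma.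
have qE h y : e (last u h) y ->
    q u h y = (1 - eps) / d%:R + eps * sigma u h y.
  by move=> hy; rewrite /q /tbrw srwE.
have q_ge0 h y : path e u h -> e (last u h) y -> 0 <= q u h y.
  move=> uh hy; rewrite qE //; have [sigma0 _ _] := hsigma u h uh.
  by rewrite addr_ge0 ?mulr_ge0 ?invr_ge0 ?subr_ge0 ?(ltW dR0).
pose Q : step_law R T := fun x h y => q x h y `^ (1 + eta).
have QE (x : t.-tuple T) : path e u x ->
    trajectory_prob Q u x = trajectory_prob q u x `^ (1 + eta).
  move=> ux; rewrite /trajectory_prob powR_prod // => i _.
  by rewrite q_ge0 ?path_take ?path_last_take.
have moment : \sum_(x in S) trajectory_prob Q u x <= (b * (1 + b)) ^+ t.
  apply: (le_trans _ (@sum_paths_trajectory_prob_le R T e Q u _ t _ _)).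
  - rewrite [leLHS]big_mkcond [leRHS]big_mkcond /=; apply: ler_sum => x _.
    case: ifP => [/hS -> //|_]; case: ifP => // _.
    by apply: prodr_ge0 => i _; exact: powR_ge0.
  - by move=> h y; exact: powR_ge0.
  - move=> h uh; have := @sum_mixture_powR_le R T _ _ eta eps (hsigma u h uh).
    rewrite he_reg -/b => /(_ d_gt0 heta0 heta1 heps0 heps).
    apply: le_trans; rewrite le_eqVlt; apply/orP; left; apply/eqP.
    apply: eq_big => y; first by rewrite inE.
    by move=> hy; rewrite /Q qE.
have r0 : 0 < (1 + eta)^-1 by rewrite invr_gt0 addr_gt0.
have r1 : (1 + eta)^-1 <= 1 by rewrite invf_le1 ?addr_gt0 // lerDl ltW.
have eta1_neq0 : 1 + eta != 0 by rewrite gt_eqF ?addr_gt0.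
set r := (1 + eta)^-1 in r0 r1.
have rE : 1 - r = eta * r by rewrite /r; field.
set n := #|S|%:R : R.
have n0 : 0 <= n by exact: ler0n.
have pE : walk_prob (srw R e) u S = n * d%:R^-1 ^+ t.
  by rewrite /walk_prob (eq_bigr _ srw_S) sumr_const -[_ *+ #|S|]mulr_natl.
rewrite pE.
(* Jensen for the q(x)^(1 + eta) and r = 1/(1 + eta), where 1 - r = eta r *)
have holder : walk_prob q u S
    <= n `^ (eta * r) * (\sum_(x in S) trajectory_prob Q u x) `^ r.
  have Qge0 x : 0 <= trajectory_prob Q u x.
    by apply: prodr_ge0 => i _; exact: powR_ge0.
  rewrite -rE (le_trans _ (sum_powR_le r0 r1 _)) //.
  rewrite le_eqVlt; apply/orP; left; apply/eqP; apply: eq_bigr => x /hS ux.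
  rewrite QE // -powRrM mulfV // powRr1 // prodr_ge0 // => i _.
  by rewrite q_ge0 ?path_take ?path_last_take.
apply: le_trans holder _.
have bt0 : 0 <= (b * (1 + b)) ^+ t.
  by rewrite exprn_ge0 // mulr_ge0 ?addr_ge0 // ltW.
apply: (@le_trans _ _ (n `^ (eta * r) * ((b * (1 + b)) ^+ t) `^ r)).
  rewrite ler_wpM2l ?powR_ge0 // ge0_ler_powR ?(ltW r0) ?nnegrE //.
  by apply: sumr_ge0 => x _; apply: prodr_ge0 => i _; exact: powR_ge0.
have -> : (b * (1 + b)) ^+ t = (d%:R^-1 ^+ t) `^ eta * (1 + b) ^+ t.
  rewrite exprMn; congr (_ * _).
  rewrite -[in RHS]powR_mulrn ?invr_ge0 ?(ltW dR0) // -powRrM mulrC powRrM.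
  by rewrite powR_mulrn ?powR_ge0 // -powR_inv1 ?(ltW dR0) // -powRrM mulN1r powRN.
rewrite (powRM r) ?powR_ge0 ?exprn_ge0 ?addr_ge0 ?(ltW b0) //.
rewrite -powRrM mulrA -powRM ?exprn_ge0 ?invr_ge0 ?(ltW dR0) //.
rewrite mulrC ler_wpM2r ?powR_ge0 //.
(* The outer power r <= 1 only decreases (1 + b)^t >= 1. *)
apply: (@le_trans _ _ ((1 + b) ^+ t)).
  rewrite -[leRHS]powRr1 ?exprn_ge0 ?addr_ge0 ?(ltW b0) // ler_powR //.
  by rewrite exprn_ege1 // lerDl ltW.
apply: (@le_trans _ _ (expR b ^+ t)).
  by rewrite lerXn2r ?nnegrE ?expR_ge0 ?addr_ge0 ?(ltW b0) // expR_ge1Dx.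
rewrite -expRM_natl ler_expR -/b ler_wpM2r ?(ltW b0) //.
by rewrite ler_peMl // ler1n.
Qed.
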